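(* Every coset coherent configuration satisfying the distributivity condition is schurian and separable.
   Context: A coherent configuration is a pair $(\Omega,S)$ where $\Omega$ is a finite set and $S$ is a partition of $\Omega\times\Omega$ (basis relations) such that $1_\Omega$ is a union of basis relations, $s^*=\{(\beta,\alpha):(\alpha,\beta)\in s\}\in S$ for all $s\in S$, and for all $r,s,t\in S$ the number $c^t_{rs}=|\alpha r\cap\beta s^*|$ is independent of $(\alpha,\beta)\in t$, where $\alpha r=\{\beta:(\alpha,\beta)\in r\}$. A fiber is a set $\Delta$ with $1_\Delta\in S$. The complex product $rs$ of $r,s\in S$ is the set of basis relations contained in $\{(\alpha,\beta):(\alpha,\gamma)\in r,(\gamma,\beta)\in s\text{ for some }\gamma\}$; for $X,Y\subseteq S$, $XY=\bigcup_{r\in X,s\in Y}rs$. The configuration is a coset coherent configuration if $ss^*s=\{s\}$ for all $s\in S$. For a fiber $\Delta$, $\mathcal L(\Delta)$ is the set of all intersections of sets $ss^*$ with $s\in S$, $s\subseteq\Delta\times\Gamma$ for some fiber $\Gamma$. The distributivity condition: $W\cap UV=(W\cap U)(W\cap V)$ for all $U,V,W\in\mathcal L(\Delta)$ and all fibers $\Delta$. Schurian: $S$ is the set of orbits on $\Omega\times\Omega$ of some permutation group on $\Omega$. Separable: for every coherent configuration $(\Omega',S')$ and every bijection $\varphi:S\to S'$ with $c^t_{rs}=c^{\varphi(t)}_{\varphi(r)\varphi(s)}$ for all $r,s,t$, there is a bijection $f:\Omega\to\Omega'$ with $\{(\alpha^f,\beta^f):(\alpha,\beta)\in s\}=\varphi(s)$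 for all $s\in S$. *)

(* Defs.v *)
From mathcomp Require Import all_boot all_fingroup.

Set Implicit Arguments.
Unset Strict Implicit.
Unset Printing Implicit Defensive.

Section BinaryRelations.

Variable T : finType.
Implicit Types (r s : {set T * T}) (D : {set T}) (x y : T).

Definition diag D : {set T * T} := [set (x, x) | x in D].

Definition transp s : {set T * T} := [set (p.2, p.1) | p in s].

Definition nbhd x r : {set T} := [set y | (x, y) \in r].

Definition rcomp r s : {set T * T} :=
  [set p | [exists z, ((p.1, z) \in r) && ((z, p.2) \in s)]].

Definition joint_nbhd r s (p : T * T) : {set T} :=
  nbhd p.1 r :&: nbhd p.2 (transp s).

(* The number c^t_{rs}, read off at some pair of t: when t is a basis relation *)
(* of a coherent configuration the choice of the pair is immaterial.           *)
Definition intersection_number r s (t : {set T * T}) : nat :=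
  if [pick p in t] is Some p then #|joint_nbhd r s p| else 0.

End BinaryRelations.

Section Configurations.

Variable T : finType.
Implicit Types (S U V W : {set {set T * T}}) (r s : {set T * T}) (D : {set T}).

Record coherent_configuration S : Prop := CoherentConfiguration {
  cc_partition : partition S [set: T * T];
  cc_diag : exists2 P : {set {set T * T}}, P \subset S & cover P = diag [set: T];
  cc_transp : {in S, forall s, transp s \in S};
  cc_regular : forall r s t, r \in S -> s \in S -> t \in S ->
    {in t &, forall p q, #|joint_nbhd r s p| = #|joint_nbhd r s q|}
}.

Definition fiber S D : bool := diag D \in S.

Definition complex_prod S r s : {set {set T * T}} := [set t in S | t \subset rcomp r s].

Definition complex_prods S U V : {set {set T * T}} :=
  \bigcup_(r in U) \bigcup_(s in V) complex_prod S r s.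

Definition coset_configuration S : Prop :=
  coherent_configuration S /\
  {in S, forall s, complex_prods S (complex_prod S s (transp s)) [set s] = [set s]}.

Definition fiber_gens S D : {set {set {set T * T}}} :=
  [set complex_prod S s (transp s)
     | s in S & [exists G : {set T}, fiber S G && (s \subset setX D G)]].

(* Only nonempty families are intersected: over an empty family \bigcap would  *)
(* be the set of all binary relations on T, which is not a subset of S.        *)
Definition fiber_lattice S D : {set {set {set T * T}}} :=
  [set \bigcap_(X in F) X | F : {set {set {set T * T}}} in
     powerset (fiber_gens S D) & F != set0].

Definition distributivity_condition S : Prop :=
  forall D, fiber S D ->
  {in fiber_lattice S D & fiber_lattice S D & fiber_lattice S D,
    forall U V W, W :&: complex_prods S U V = complex_prods S (W :&: U) (W :&: V)}.

Definition pair_act (p : T * T) (a : {perm T}) : T * T := (aperm p.1 a, aperm p.2 a).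

Fact pair_act_is_action : is_action [set: {perm T}] pair_act.
Proof.
apply: is_total_action => [[x y]|[x y] a b]; rewrite /pair_act /=.
  by rewrite !act1.
by rewrite !actM.
Qed.

Canonical pair_action := Action pair_act_is_action.

Definition schurian S : Prop :=
  exists G : {group {perm T}}, S = [set orbit pair_action G p | p : T * T].

End Configurations.

(* A bijection phi : S -> S' is given by a map on all binary relations, of     *)
(* which only the restriction to S matters.                                    *)
Definition algebraic_isomorphism (T T' : finType) (S : {set {set T * T}})
    (S' : {set {set T' * T'}}) (phi : {set T * T} -> {set T' * T'}) : Prop :=
  [/\ {in S &, injective phi}, phi @: S = S' &
      {in S & S & S, forall r s t,
        intersection_number r s t = intersection_number (phi r) (phi s) (phi t)}].

Definition separable (T : finType) (S : {set {set T * T}}) : Prop :=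
  forall (T' : finType) (S' : {set {set T' * T'}})
         (phi : {set T * T} -> {set T' * T'}),
    coherent_configuration S' -> algebraic_isomorphism S S' phi ->
  exists2 f : T -> T', bijective f &
    {in S, forall s : {set T * T}, [set (f p.1, f p.2) | p in s] = phi s}.

(* Main.v *)
Require Import Defs.
From mathcomp Require Import all_boot all_fingroup.

Set Implicit Arguments.
Unset Strict Implicit.
Unset Printing Implicit Defensive.

(* Let phi be an algebraic isomorphism from S to S'. A map f defined on a set  *)
(* A of points and compatible with phi is extended to a further point g: the   *)
(* admissible images of g are the common points of the sets f(a) phi(r(a, g)), *)
(* a in A. Any two of these meet because phi preserves intersection numbers,   *)
(* and since S is a coset configuration each is a class of the equivalence     *)
(* relation phi(s s* ), s = r(g, a), on one fiber. Distributivity gives a      *)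
(* Helly theorem (a Chinese remainder theorem) for such classes, so that they  *)
(* all have a common point. Separability is the case of an empty A; schurity   *)
(* is the case phi = id, starting from a pair (x, y) -> (x', y') of equal      *)
(* colors.                                                                     *)

(** A nonzero intersection number says that a third vertex exists, so triangles can be carried
    across [phi] in both directions ([color_triangle], [pcolor_triangle]). Pulling paths of [T']
    back to [T] makes s s* s = {s} available on [T'] ([pcolor_coset]), hence the coset property of
    the candidate sets ([candidate_coset]), and likewise distributivity ([lat_rel_distr]), which is
    the case of three cosets in [helly]. This yields the one-point extension [extend_point];
    iterating it defines the map on all of [T], and counting neighbours makes it bijective
    ([total_bij]). *)

Section Helly.

Variables (T : finType) (L : rel T -> Prop).

(** [E] need not be an equivalence, and the empty set qualifies; nonemptiness will come from
    pairwise intersections. *)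
Definition is_coset (E : rel T) (C : {set T}) : Prop :=
  {in C &, forall x y, E x y} /\ (forall x y, E x y -> (x \in C) = (y \in C)).

Hypothesis L_meet : forall E F, L E -> L F -> L [rel x y | E x y && F x y].
(** Pointwise form of the inclusion of W ∩ UV in (W ∩ U)(W ∩ V), with [E], [F], [G] in the roles of
    W, U, V. *)
Hypothesis L_distr : forall E F G x y z, L E -> L F -> L G ->
  E x y -> F x z -> G z y ->
  exists w, [/\ E x w, F x w, E w y & G w y].

Let L_coset C := exists2 E, L E & is_coset E C.

Lemma L_cosetI C D : L_coset C -> L_coset D -> L_coset (C :&: D).
Proof.
move=> [E LE [CE EC]] [F LF [DF FD]]; exists [rel x y | E x y && F x y].
  exact: L_meet.
split=> [x y /setIP[xC xD] /setIP[yC yD]|x y /= /andP[Exy Fxy]].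
  by rewrite /= CE ?DF.
by rewrite !inE (EC x y) // (FD x y).
Qed.

(** Points of the three pairwise intersections form a triangle for [L_distr]; the point it returns
    is tied to [x] by [E] and [F] and to [y] by [G], so it lies in all three cosets. *)
Lemma helly3 C D B : L_coset C -> L_coset D -> L_coset B ->
  C :&: D != set0 -> C :&: B != set0 -> D :&: B != set0 ->
  (C :&: D) :&: (C :&: B) != set0.
Proof.
move=> [E LE [CE EC]] [F LF [DF FD]] [G LG [BG GB]].
case/set0Pn=> x /setIP[xC xD] /set0Pn[y /setIP[yC yB]] /set0Pn[z /setIP[zD zB]].
have [w [Exw Fxw Ewy Gwy]] :=
  L_distr LE LF LG (CE _ _ xC yC) (DF _ _ xD zD) (BG _ _ zB yB).
apply/set0Pn; exists w.
by rewrite !inE -(EC _ _ Exw) xC -(FD _ _ Fxw) xD (GB _ _ Gwy) yB.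
Qed.

(* Intersecting every member with the first one preserves the hypotheses, by   *)
(* the case of three cosets.                                                   *)
Lemma helly C0 (cs : seq {set T}) :
    (forall C, C \in C0 :: cs -> L_coset C) ->
    {in C0 :: cs &, forall C D, C :&: D != set0} ->
  exists x, forall C, C \in C0 :: cs -> x \in C.
Proof.
have [n] := ubnP (size cs); elim: n => // n IHn in C0 cs *.
case: cs => [|C1 cs] szcs csL csI.
  have /set0Pn[x /setIP[xC _]] := csI C0 C0 (mem_head _ _) (mem_head _ _).
  by exists x => C; rewrite inE => /eqP->.
have C0in := mem_head C0 (C1 :: cs).
have insub D : D \in C1 :: cs -> D \in [:: C0, C1 & cs].
  by rewrite [in X in _ -> X]inE orbC => ->.
have [|C|C D|x xP] := IHn (C0 :&: C1) [seq C0 :&: D | D <- cs].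
- by rewrite size_map.
- rewrite -(map_cons (setI C0)) => /mapP[D Dcs ->].
  by apply: L_cosetI; apply: csL => //; apply: insub.
- rewrite -(map_cons (setI C0)) => /mapP[A Acs ->] /mapP[B Bcs ->].
  by apply: helly3; do ?[apply: csL | apply: csI]; do ?exact: insub.
exists x => C; rewrite inE => /predU1P[->|Ccs].
  by have /setIP[] := xP _ (mem_head _ _).
have /setIP[] // : x \in C0 :&: C.
by apply: xP; rewrite -(map_cons (setI C0)); apply: map_f.
Qed.

End Helly.

(** * Colors, fibers and lattices of a coherent configuration *)

Section Coherent.

Variables (T : finType) (S : {set {set T * T}}).
Hypothesis cohS : coherent_configuration S.
Implicit Types (r s t : {set T * T}) (x y z : T).

Definition color x y : {set T * T} := pblock S (x, y).

Let trivS : trivIset S.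
Proof. by case/and3P: (cc_partition cohS). Qed.

Lemma mem_color x y : (x, y) \in color x y.
Proof. by rewrite mem_pblock (cover_partition (cc_partition cohS)). Qed.

Lemma color_mem x y : color x y \in S.
Proof. by rewrite pblock_mem // (cover_partition (cc_partition cohS)). Qed.

Lemma colorE s x y : s \in S -> ((x, y) \in s) = (color x y == s).
Proof.
move=> sS; apply/idP/eqP=> [|<-]; last exact: mem_color.
exact: def_pblock.
Qed.

Lemma color_surj s : s \in S -> exists x y, color x y = s.
Proof.
move=> sS; have /set0Pn[[x y] xys] := partition_neq0 (cc_partition cohS) sS.
by exists x, y; apply/eqP; rewrite -colorE.
Qed.

Lemma mem_transp s x y : ((x, y) \in transp s) = ((y, x) \in s).
Proof.
apply/imsetP/idP=> [[[a b] abs [-> ->]] // |yxs]; by exists (y, x).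
Qed.

Lemma color_transp x y : transp (color x y) = color y x.
Proof.
by apply/esym/eqP; rewrite -colorE ?mem_transp ?mem_color ?cc_transp ?color_mem.
Qed.

Lemma mem_joint_nbhd r s x y z :
  (z \in joint_nbhd r s (x, y)) = ((x, z) \in r) && ((z, y) \in s).
Proof. by rewrite !inE /= mem_transp. Qed.

Lemma intersection_numberE r s x y : r \in S -> s \in S ->
  intersection_number r s (color x y) = #|joint_nbhd r s (x, y)|.
Proof.
move=> rS sS; rewrite /intersection_number.
case: pickP => [p pc|/(_ (x, y))]; last by rewrite /= mem_color.
by apply: (cc_regular cohS rS sS (color_mem x y)); rewrite ?mem_color.
Qed.

Lemma color_diag x y z : color x x = color y z -> y = z.
Proof.
move=> cE; have [P /subsetP PS PE] := cc_diag cohS.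
have : (x, x) \in cover P by rewrite PE; apply/imsetP; exists x.
case/bigcupP=> s sP; rewrite colorE ?PS // cE -colorE ?PS // => yzs.
have : (y, z) \in cover P by apply/bigcupP; exists s.
by rewrite PE => /imsetP[w _ [-> ->]].
Qed.

(** One pair decides for its whole basis relation, since the number of intermediate points is
    constant on it. *)
Lemma mem_complex_prod r s x y : r \in S -> s \in S ->
  reflect (exists2 z, color x z = r & color z y = s)
          (color x y \in complex_prod S r s).
Proof.
move=> rS sS; rewrite inE color_mem /=; apply: (iffP subsetP) => [|[z <- <-]].
  move/(_ _ (mem_color x y)); rewrite inE /= => /existsP[z].
  by rewrite !colorE // => /andP[/eqP ? /eqP ?]; exists z.
case=> x' y'; rewrite (colorE _ _ (color_mem x y)) inE /= => /eqP cE.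
have : 0 < #|joint_nbhd (color x z) (color z y) (x', y')|.
  rewrite -intersection_numberE ?color_mem // cE intersection_numberE ?color_mem //.
  by apply/card_gt0P; exists z; rewrite mem_joint_nbhd !mem_color.
by case/card_gt0P=> z'; rewrite mem_joint_nbhd => ?; apply/existsP; exists z'.
Qed.

Lemma mem_complex_prods (U V : {set {set T * T}}) x y :
    U \subset S -> V \subset S ->
  reflect (exists z, color x z \in U /\ color z y \in V)
          (color x y \in complex_prods S U V).
Proof.
move=> /subsetP US /subsetP VS.
apply: (iffP bigcupP) => [[r rU /bigcupP[s sV]]|[z [zU zV]]].
  case/(mem_complex_prod _ _ (US _ rU) (VS _ sV)) => z zr zs.
  by exists z; rewrite zr zs.
exists (color x z) => //; apply/bigcupP; exists (color z y) => //.
by apply/mem_complex_prod; rewrite ?color_mem //; exists z.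
Qed.

Definition fiber_at x : {set T} := [set y | color y y == color x x].

Lemma diag_fiber_at x : diag (fiber_at x) = color x x.
Proof.
apply/setP=> -[y z]; rewrite [RHS]colorE ?color_mem //.
apply/imsetP/eqP=> [[w] | cE]; first by rewrite inE => /eqP cE [-> ->].
by move: (cE); rewrite (color_diag (esym cE)) => wE; exists z; rewrite ?inE ?wE.
Qed.

Lemma fiber_fiber_at x : fiber S (fiber_at x).
Proof. by rewrite /fiber diag_fiber_at color_mem. Qed.

(** The degenerate triangle x, x, y is copied over (x', y'); its middle vertex must be x' by
    [color_diag]. *)
Lemma color_source x y x' y' : color x y = color x' y' -> color x x = color x' x'.
Proof.
move=> cE; have : color x y \in complex_prod S (color x x) (color x y).
  by apply/mem_complex_prod; rewrite ?color_mem //; exists x.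
rewrite [X in X \in _]cE => /mem_complex_prod[]; rewrite ?color_mem // => z zE _.
by rewrite -zE (color_diag (esym zE)).
Qed.

Lemma color_sub_fibers x y : color x y \subset setX (fiber_at x) (fiber_at y).
Proof.
apply/subsetP=> -[a b]; rewrite colorE ?color_mem // => /eqP cE.
rewrite !inE /= (color_source cE) eqxx /=.
have cE' : color b a = color y x by rewrite -color_transp cE color_transp.
by rewrite (color_source cE') eqxx.
Qed.

Lemma fiber_lattice_sub U D : U \in fiber_lattice S D -> U \subset S.
Proof.
case/imsetP=> F; rewrite !inE => /andP[/subsetP Fgen /set0Pn[X XF]] ->.
apply: (subset_trans (bigcap_inf X XF)); have /imsetP[s _ ->] := Fgen X XF.
by apply/subsetP=> t; rewrite inE => /andP[].
Qed.

Lemma fiber_latticeI U V D : U \in fiber_lattice S D -> V \in fiber_lattice S D ->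
  U :&: V \in fiber_lattice S D.
Proof.
case/imsetP=> F; rewrite !inE => /andP[Fgen F0] ->.
case/imsetP=> G; rewrite !inE => /andP[Ggen G0] ->.
apply/imsetP; exists (F :|: G); last by rewrite bigcap_setU.
by rewrite !inE subUset Fgen Ggen setU_eq0 negb_and F0.
Qed.

Lemma color_gen_lattice x y :
  complex_prod S (color x y) (color y x) \in fiber_lattice S (fiber_at x).
Proof.
apply/imsetP; exists [set complex_prod S (color x y) (color y x)].
  rewrite !inE sub1set -card_gt0 cards1 andbT; apply/imsetP; exists (color x y).
    rewrite inE color_mem; apply/existsP; exists (fiber_at y).
    by rewrite fiber_fiber_at color_sub_fibers.
  by rewrite color_transp.
by rewrite big_set1.
Qed.

End Coherent.

(** * Extension of partial isomorphisms along [phi] *)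

Section Extension.

Variables (T T' : finType) (S : {set {set T * T}}) (S' : {set {set T' * T'}}).
Variable phi : {set T * T} -> {set T' * T'}.
Hypotheses (cohS : coherent_configuration S) (cohS' : coherent_configuration S').
Hypothesis phi_iso : algebraic_isomorphism S S' phi.

(* Pulling the colors of S' back to S lets pairs of points of T and of T' be   *)
(* compared by an equality of colors, without mentioning phi.                  *)
Definition pcolor x' y' : {set T * T} :=
  odflt set0 [pick t in S | phi t == color S' x' y'].

Let phi_mem s : s \in S -> phi s \in S'.
Proof. by case: phi_iso => _ <- _; apply: imset_f. Qed.

Lemma pcolorP x' y' : pcolor x' y' \in S /\ phi (pcolor x' y') = color S' x' y'.
Proof.
rewrite /pcolor; case: pickP => [t /andP[tS /eqP] // | no].
have := color_mem cohS' x' y'; case: phi_iso => _ {2}<- _ /imsetP[t tS tE].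
by have := no t; rewrite /= tS tE eqxx.
Qed.

Lemma pcolorE s x' y' : s \in S -> ((x', y') \in phi s) = (pcolor x' y' == s).
Proof.
move=> sS; have [pS pE] := pcolorP x' y'.
rewrite (colorE cohS') ?phi_mem // -pE; apply/eqP/eqP=> [|-> //].
by case: phi_iso => inj _ _; apply: inj.
Qed.

Lemma pcolor_ex x' y' : exists x y, color S x y = pcolor x' y'.
Proof. by apply: color_surj; case: (pcolorP x' y'). Qed.

Lemma color_ex x y : exists x' y', color S x y = pcolor x' y'.
Proof.
have [x' [y' xyE]] := color_surj cohS' (phi_mem (color_mem cohS x y)).
by exists x', y'; apply/esym/eqP; rewrite -pcolorE ?color_mem // -xyE mem_color.
Qed.

Lemma card_joint_nbhd_phi x y x' y' r s : color S x y = pcolor x' y' ->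
  r \in S -> s \in S ->
  #|joint_nbhd r s (x, y)| = #|joint_nbhd (phi r) (phi s) (x', y')|.
Proof.
move=> cE rS sS; rewrite -(intersection_numberE cohS) //.
rewrite -(intersection_numberE cohS') ?phi_mem //.
have [_ <-] := pcolorP x' y'; rewrite -cE; case: phi_iso => _ _ -> //.
exact: color_mem.
Qed.

Lemma color_triangle x y z x' y' : color S x y = pcolor x' y' ->
  exists z', color S x z = pcolor x' z' /\ color S z y = pcolor z' y'.
Proof.
move=> cE; set r := color S x z; set s := color S z y.
have rS : r \in S by exact: color_mem.
have sS : s \in S by exact: color_mem.
have : 0 < #|joint_nbhd (phi r) (phi s) (x', y')|.
  rewrite -(card_joint_nbhd_phi cE) //.
  by apply/card_gt0P; exists z; rewrite mem_joint_nbhd !mem_color.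
case/card_gt0P=> z'; rewrite mem_joint_nbhd !pcolorE // => /andP[/eqP xz /eqP zy].
by exists z'; rewrite xz zy.
Qed.

Lemma pcolor_triangle x y x' y' z' : color S x y = pcolor x' y' ->
  exists z, color S x z = pcolor x' z' /\ color S z y = pcolor z' y'.
Proof.
move=> cE; set r := pcolor x' z'; set s := pcolor z' y'.
have [rS _] : r \in S /\ _ := pcolorP x' z'.
have [sS _] : s \in S /\ _ := pcolorP z' y'.
have : 0 < #|joint_nbhd r s (x, y)|.
  rewrite (card_joint_nbhd_phi cE) //.
  by apply/card_gt0P; exists z'; rewrite mem_joint_nbhd !pcolorE ?eqxx.
case/card_gt0P=> z; rewrite mem_joint_nbhd !(colorE cohS) // => /andP[/eqP ? /eqP ?].
by exists z.
Qed.

(** Pulling x' back as a third vertex over (x, x) forces it to be x, so (x', y') and (x', x') have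
    the same color. *)
Lemma pcolor_diag x x' y' : color S x x = pcolor x' y' -> x' = y'.
Proof.
move=> cE; have [z [c1 c2]] := pcolor_triangle x' cE.
have zx : z = x by apply: (color_diag cohS (x := x)); rewrite cE.
move: c1; rewrite zx cE => pE; have [_ E] := pcolorP x' y'.
have [_ E'] := pcolorP x' x'.
by apply: (color_diag cohS' (x := x')); rewrite -E -E' pE.
Qed.

Lemma pcolor_source x y x' y' :
  color S x y = pcolor x' y' -> color S x x = pcolor x' x'.
Proof. by case/(color_triangle x) => z' [c1 c2]; rewrite {2}(pcolor_diag c1). Qed.

(** Compatibility of [phi] with transposition follows from the intersection numbers: copying x, y, x
    gives some z', perhaps not y', but with (x', z') colored like (x', y'). *)
Lemma pcolor_sym x y x' y' :
  color S x y = pcolor x' y' -> color S y x = pcolor y' x'.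
Proof.
move=> cE; have [z' [c1 c2]] := color_triangle y (pcolor_source cE).
have [_ E1] := pcolorP x' z'; have [_ E2] := pcolorP x' y'.
have [S3 E3] := pcolorP y' x'.
apply/esym/eqP; rewrite -pcolorE ?color_mem // c2.
have [_ ->] := pcolorP z' x'.
by rewrite -color_transp // mem_transp -E1 -c1 cE E2 mem_color.
Qed.

Hypothesis cosetS : coset_configuration S.
Hypothesis distrS : distributivity_condition S.

(** The coset hypothesis concerns [S] alone, so the path z', x', w', y' is pulled back to a path p,
    a, b, q with colors r, r*, r. *)
Lemma pcolor_coset x y z' x' y' w' : pcolor z' x' = color S x y ->
  pcolor w' x' = color S x y -> pcolor w' y' = color S x y ->
  pcolor z' y' = color S x y.
Proof.
set r := color S x y => zx wx wy.
have [p [q pqE]] := pcolor_ex z' y'.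
have [b [pb bq]] := pcolor_triangle w' pqE.
have [a [pa ab]] := pcolor_triangle x' pb.
have rS : r \in S by exact: color_mem.
have rcE : r = color S p a by rewrite pa.
have rtS : transp r \in S by exact: cc_transp.
have : color S p q \in complex_prods S (complex_prod S r (transp r)) [set r].
  apply/mem_complex_prods; rewrite ?sub1set //.
    by apply/subsetP=> t; rewrite inE => /andP[].
  exists b; split; last by rewrite bq wy set11.
  apply/mem_complex_prod; rewrite // ; exists a; rewrite ?pa //.
  rewrite -(color_transp cohS b a); congr transp.
  by rewrite -wx; apply: pcolor_sym.
by case: cosetS => _ -> //; rewrite inE pqE => /eqP.
Qed.

(** The candidates live in [T'] while the lattice is that of [S]; its members are read on [T']
    through [pcolor]. *)
Let lat_rel x (E : rel T') : Prop :=
  exists2 U, U \in fiber_lattice S (fiber_at S x) &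
    forall x' y', E x' y' = (pcolor x' y' \in U).

Let lat_relI x (E F : rel T') : lat_rel x E -> lat_rel x F ->
  lat_rel x [rel x' y' | E x' y' && F x' y'].
Proof.
move=> [U UL EU] [V VL FV]; exists (U :&: V); first exact: fiber_latticeI.
by move=> x' y' /=; rewrite inE EU FV.
Qed.

Let lat_rel_distr x (E F G : rel T') x' y' z' :
  lat_rel x E -> lat_rel x F -> lat_rel x G -> E x' y' -> F x' z' -> G z' y' ->
  exists w', [/\ E x' w', F x' w', E w' y' & G w' y'].
Proof.
move=> [W WL EW] [U UL FU] [V VL GV]; rewrite EW FU GV => xyW xzU zyV.
have [WS US VS] : [/\ W \subset S, U \subset S & V \subset S].
  by split; apply: fiber_lattice_sub; eassumption.
have [p [q pqE]] := pcolor_ex x' y'.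
have [z [pz zq]] := pcolor_triangle z' pqE.
have : color S p q \in W :&: complex_prods S U V.
  rewrite inE pqE xyW -pqE; apply/mem_complex_prods => //.
  by exists z; rewrite pz zq.
rewrite (distrS (fiber_fiber_at cohS x)) //.
case/mem_complex_prods; rewrite ?subIset ?WS // => w; rewrite !inE.
have [w' [-> ->]] := color_triangle w pqE.
by case=> /andP[? ?] /andP[? ?]; exists w'; rewrite !EW FU GV.
Qed.

Definition partial_isomorphism (A : {set T}) (f : T -> T') : Prop :=
  {in A &, forall x y, color S x y = pcolor (f x) (f y)}.

(** With s = r(x, a), two candidates are joined through z', so their color is in s s*. Conversely a
    pair colored in s s* has a common neighbour w', and [pcolor_coset] transfers candidacy from one
    to the other. *)
Lemma candidate_coset x a z' : exists2 E, lat_rel x E &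
  is_coset E [set x' | pcolor z' x' == color S a x].
Proof.
exists [rel x' y' | pcolor x' y' \in complex_prod S (color S x a) (color S a x)].
  by exists (complex_prod S (color S x a) (color S a x)); rewrite ?color_gen_lattice.
split=> [x' y' | x' y' /=].
  rewrite !inE /= => /eqP zx /eqP zy; have [p [q pqE]] := pcolor_ex x' y'.
  rewrite -pqE; apply/mem_complex_prod; rewrite ?color_mem //.
  have [z [pz zq]] := pcolor_triangle z' pqE; exists z; last by rewrite zq.
  by rewrite pz; apply/esym/pcolor_sym.
have [p [q pqE]] := pcolor_ex x' y'; rewrite -pqE.
case/mem_complex_prod; rewrite ?color_mem // => w pw wq.
have [w' [c1 c2]] := color_triangle w pqE.
have wx : pcolor w' x' = color S a x.
  by rewrite pw in c1; apply/esym/pcolor_sym.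
have wy : pcolor w' y' = color S a x by rewrite -c2.
rewrite !inE; apply/eqP/eqP=> zxy; first exact: pcolor_coset zxy wx wy.
exact: pcolor_coset zxy wy wx.
Qed.

Lemma extend_point A f x : partial_isomorphism A f ->
  exists x', color S x x = pcolor x' x' /\
    {in A, forall a, color S a x = pcolor (f a) x'}.
Proof.
(* [helly] needs a first coset, so empty [A] is separate: any point with the right loop color will
   do. *)
move=> fA; case aE: (enum A) => [|a0 s].
  have [x' [y' xE]] := color_ex x x; exists x'.
  split=> [|a]; last by rewrite -mem_enum aE.
  by rewrite xE (pcolor_diag xE).
pose C a := [set x' | pcolor (f a) x' == color S a x].
have mA a : (a \in a0 :: s) = (a \in A) by rewrite -aE mem_enum.
have [|D B|x' x'P] := helly (@lat_relI x) (@lat_rel_distr x) (C0 := C a0)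
    (cs := map C s).
- move=> D; rewrite -map_cons => /mapP[a _ ->]; exact: candidate_coset.
- rewrite -map_cons => /mapP[a aA ->] /mapP[b bA ->]; rewrite !mA in aA bA.
  (* Two candidate sets meet: copy the triangle a, x, b over (f a, f b). *)
  have [x' [c1 c2]] := color_triangle x (fA a b aA bA).
  apply/set0Pn; exists x'; rewrite !inE c1 eqxx eq_sym.
  by apply/eqP/pcolor_sym.
exists x'; have x'A : {in A, forall a, color S a x = pcolor (f a) x'}.
  move=> a aA; have : x' \in C a by apply: x'P; rewrite -map_cons map_f ?mA.
  by rewrite inE => /eqP.
split=> //; have a0A : a0 \in A by rewrite -mA mem_head.
exact: pcolor_source (pcolor_sym (x'A a0 a0A)).
Qed.

Lemma extend_partial A f : partial_isomorphism A f ->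
  exists2 g, partial_isomorphism setT g & {in A, g =1 f}.
Proof.
have [n] := ubnP #|~: A|; elim: n => // n IHn in A f * => szA fA.
have [A0|/set0Pn[x]] := eqVneq (~: A) set0.
  by exists f => //; rewrite -setC0 -A0 setCK.
rewrite inE => xA; have [x' [xx xA']] := extend_point x fA.
pose g y := if y == x then x' else f y.
have gA : {in A, g =1 f}.
  by move=> a aA; rewrite /g; case: eqP aA xA => // -> ->.
have gx : g x = x' by rewrite /g eqxx.
have [||h hT hg] := IHn (x |: A) g.
- rewrite ltnS in szA; apply: leq_trans szA; rewrite setCU setIC -setDE.
  by rewrite (cardsD1 x (~: A)) inE xA add1n leqnn.
- move=> a b /setU1P[->|aA] /setU1P[->|bA]; rewrite ?gx ?gA //; last exact: fA.
    exact/pcolor_sym/xA'.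
  exact: xA'.
by exists h => // a aA; rewrite hg ?gA // inE aA orbT.
Qed.

(** For surjectivity, the t-neighbours of x and the [phi t]-neighbours of f x are equinumerous, so
    [f] maps the former onto the latter, among which is y'. *)
Lemma total_bij f : partial_isomorphism setT f -> bijective f.
Proof.
move=> fT; have fE x y : color S x y = pcolor (f x) (f y) by apply: fT; rewrite inE.
have finj : injective f.
  by move=> x y fxy; apply: (color_diag cohS (x := x)); rewrite !fE fxy.
suff fsurj y' : y' \in codom f.
  by exists (fun y' => iinv (fsurj y')) => [x|y']; [apply: finj|]; rewrite f_iinv.
(* Only some point of [T] is wanted; y' guarantees that there is one. *)
have [x [_ _]] := pcolor_ex y' y'.
pose t := pcolor (f x) y'; have [tS _] : t \in S /\ _ := pcolorP (f x) y'.
have cardE := card_joint_nbhd_phi (fE x x) tS (cc_transp cohS tS).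
have sub : f @: joint_nbhd t (transp t) (x, x) \subset
    joint_nbhd (phi t) (phi (transp t)) (f x, f x).
  apply/subsetP=> _ /imsetP[z zt ->]; move: zt; rewrite !mem_joint_nbhd.
  by rewrite !pcolorE ?cc_transp // -!fE -!colorE ?cc_transp.
have /eqP imE : f @: joint_nbhd t (transp t) (x, x) ==
    joint_nbhd (phi t) (phi (transp t)) (f x, f x).
  by rewrite eqEcard sub -cardE card_imset /=.
have : y' \in joint_nbhd (phi t) (phi (transp t)) (f x, f x).
  rewrite mem_joint_nbhd !pcolorE ?cc_transp ?eqxx //=; apply/eqP.
  have [p [q pqE]] := pcolor_ex (f x) y'.
  by rewrite -(pcolor_sym pqE) /t -pqE color_transp.
by rewrite -imE => /imsetP[z _ ->]; apply: codom_f.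
Qed.

End Extension.

(** * Separability and schurity *)

Lemma algebraic_isomorphism_id (T : finType) (S : {set {set T * T}}) :
  algebraic_isomorphism S S id.
Proof. by split=> //; rewrite imset_id. Qed.

Lemma pcolor_id (T : finType) (S : {set {set T * T}}) x y :
  coherent_configuration S -> pcolor S S id x y = color S x y.
Proof. by move=> cohS; have [] := pcolorP cohS (algebraic_isomorphism_id S) x y. Qed.

Lemma separable_coset (T : finType) (S : {set {set T * T}}) :
  coset_configuration S -> distributivity_condition S -> separable S.
Proof.
move=> cosetS distrS T' S' phi cohS' isoS; have cohS := proj1 cosetS.
(* The empty partial map is still encoded by a total function, whose values are arbitrary. *)
have [f0 _] := fin_all_exists (fun x => color_ex cohS cohS' isoS x x).
have f0P : partial_isomorphism S S' phi set0 f0 by move=> x y; rewrite inE.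
have [f fT _] := extend_partial cohS cohS' isoS cosetS distrS f0P.
have fbij := total_bij cohS cohS' isoS fT; exists f => // s sS.
have inE' x y : ((f x, f y) \in phi s) = ((x, y) \in s).
  by rewrite (pcolorE cohS' isoS) // (colorE cohS) // fT ?inE.
have [g fK gK] := fbij.
apply/setP=> -[x' y']; rewrite -(gK x') -(gK y') inE'.
apply/imsetP/idP=> [[[x y] xys [/(bij_inj fbij)-> /(bij_inj fbij)->]] // | xys].
by exists (g x', g y').
Qed.

Lemma schurian_coset (T : finType) (S : {set {set T * T}}) :
  coset_configuration S -> distributivity_condition S -> schurian S.
Proof.
move=> cosetS distrS; have cohS := proj1 cosetS.
pose Aut := [set a : {perm T} |
  [forall x, forall y, color S (a x) (a y) == color S x y]].
have AutP (a : {perm T}) :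
    reflect (forall x y, color S (a x) (a y) = color S x y) (a \in Aut).
  rewrite inE; apply: (iffP forallP) => [h x y|h x]; last first.
    by apply/forallP=> y; rewrite h.
  by apply/eqP; have /forallP := h x.
have gAut : group_set Aut.
  apply/group_setP; split=> [|a b /AutP aP /AutP bP]; apply/AutP=> x y.
    by rewrite !perm1.
  by rewrite !permM bP aP.
have orbitE x y : orbit (pair_action T) (group gAut) (x, y) = color S x y.
  apply/setP=> -[x' y']; rewrite [RHS](colorE cohS) ?color_mem //.
  apply/orbitP/eqP=> [[a /AutP aP [<- <-]] | cE]; first exact: aP.
  have isoS := algebraic_isomorphism_id S.
  pose f z := if z == x then x' else y'.
  have fx : f x = x' by rewrite /f eqxx.
  (* If y = x, then (x', y') has a loop color, so x' = y' and [f] is consistent. *)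
  have fy : f y = y'.
    rewrite /f; case: eqP => // yx; apply: (color_diag cohS (x := x)).
    by rewrite cE yx.
  have xyP : partial_isomorphism S S id [set x; y] f.
    have cE1 := esym (color_source cohS cE).
    have cE' : color S y' x' = color S y x.
      by rewrite -(color_transp cohS x y) -(color_transp cohS x' y') cE.
    have cE2 := esym (color_source cohS cE').
    by move=> a b /set2P[]-> /set2P[]->; rewrite ?fx ?fy pcolor_id.
  have [h hT hf] := extend_partial cohS cohS isoS cosetS distrS xyP.
  have hinj := bij_inj (total_bij cohS cohS isoS hT).
  exists (perm hinj).
    by apply/AutP=> a b; rewrite !permE [RHS]hT ?inE // pcolor_id.
  by rewrite /= /pair_act /= /aperm !permE !hf ?set21 ?set22 // fx fy.
exists (group gAut); apply/setP=> s; apply/idP/imsetP=> [sS|[[x y] _ ->]].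
  by have [x [y <-]] := color_surj cohS sS; exists (x, y); rewrite ?orbitE.
by rewrite orbitE color_mem.
Qed.

Theorem theorem6p2 (Omega : finType) (S : {set {set Omega * Omega}})
    (cosetS : coset_configuration S) (distrS : distributivity_condition S) :
  schurian S /\ separable S.
Proof.
by split; [apply: schurian_coset | apply: separable_coset].
Qed.
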